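(* Let $t\ge 1$ and $\Delta\ge 1$ be integers. For any graph $G$ of maximum degree $\Delta$, it holds that $\omega(L(G)^t)\le \frac32\Delta^t$.
   Context: Graphs are finite and simple. The line graph $L(G)$ of a graph $G$ has the edges of $G$ as its vertices, two distinct edges being adjacent if they share an endpoint. For a graph $H$, the $t$-th power $H^t$ is the graph on the vertex set of $H$ in which two distinct vertices are adjacent if and only if their distance in $H$ is at most $t$. $\omega(H)$ denotes the clique number of $H$. *)

(* Defs.v *)
From mathcomp Require Import all_boot.

Set Implicit Arguments.
Unset Strict Implicit.
Unset Printing Implicit Defensive.

Record sgraph := SGraph {
  vertex :> finType;
  adj : rel vertex;
  adj_sym : symmetric adj;
  adj_irr : irreflexive adj
}.

Definition degree (G : sgraph) (x : G) : nat := #|[set y | adj x y]|.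

(* 0 for the graph without vertices. *)
Definition max_degree (G : sgraph) : nat := \max_(x : G) degree x.

Definition edges (G : sgraph) : {set {set G}} :=
  [set [set p.1; p.2] | p : G * G & adj p.1 p.2].

Section LineGraph.
Variable G : sgraph.

Definition edge_type : finType := {E : {set G} | E \in edges G}.

Definition line_adj : rel edge_type :=
  fun E F => (E != F) && (val E :&: val F != set0).

Lemma line_adj_sym : symmetric line_adj.
Proof. by move=> E F; rewrite /line_adj eq_sym setIC. Qed.

Lemma line_adj_irr : irreflexive line_adj.
Proof. by move=> E; rewrite /line_adj eqxx. Qed.

Definition line_graph : sgraph := SGraph line_adj_sym line_adj_irr.

End LineGraph.

Section Distance.
Variable H : sgraph.
Implicit Types x y : H.

Definition walk (n : nat) x y : bool :=
  [exists p : n.-tuple H, path (@adj H) x p && (y == last x p)].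

Lemma walk_sym n x y : walk n x y = walk n y x.
Proof.
suff W u v : walk n u v -> walk n v u by apply/idP/idP; apply: W.
case/existsP=> p /andP[pth /eqP ->]; apply/existsP.
have sz : size (rev (belast u p)) == n by rewrite size_rev size_belast size_tuple.
exists (Tuple sz) => /=; rewrite rev_path.
rewrite (@eq_path _ _ (@adj H)) => [|a b]; last by rewrite adj_sym.
rewrite pth /=.
by case: (tval p) => [|a q] //=; rewrite rev_cons last_rcons.
Qed.

Lemma connect_walk x y : connect (@adj H) x y -> exists n, walk n x y.
Proof.
case/connectP=> p pth ->; exists (size p).
by apply/existsP; exists (in_tuple p); rewrite pth eqxx.
Qed.

(* [None] is infinite distance: x and y lie in different components. *)
Definition dist x y : option nat :=
  if @idP (connect (@adj H) x y) is ReflectT cxy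
  then Some (ex_minn (connect_walk cxy)) else None.

Lemma dist_sym x y : dist x y = dist y x.
Proof.
have cs : connect_sym (@adj H) by apply: sym_connect_sym; apply: adj_sym.
rewrite /dist; case: {-}_ / idP => [c|n]; case: {-}_ / idP => [c'|n'] //.
- congr Some; case: ex_minnP => m wm minm; case: ex_minnP => k wk mink.
  by apply/eqP; rewrite eqn_leq minm 1?walk_sym // mink // walk_sym.
- by case: n'; rewrite cs.
- by case: n; rewrite cs.
Qed.

Variable t : nat.

Definition power_adj : rel H :=
  fun x y => (x != y) && (if dist x y is Some d then d <= t else false).

Lemma power_adj_sym : symmetric power_adj.
Proof. by move=> x y; rewrite /power_adj eq_sym dist_sym. Qed.

Lemma power_adj_irr : irreflexive power_adj.
Proof. by move=> x; rewrite /power_adj eqxx. Qed.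

Definition graph_power : sgraph := SGraph power_adj_sym power_adj_irr.

End Distance.

Definition clique (H : sgraph) (K : {set H}) : bool :=
  [forall x in K, forall y in K, (x != y) ==> adj x y].

Definition clique_number (H : sgraph) : nat :=
  \max_(K : {set H} | clique K) #|K|.

(* Main.v *)
Require Import Defs.
From mathcomp Require Import all_boot all_order all_algebra.
From mathcomp Require Import zify.
Set Implicit Arguments.
Unset Strict Implicit.
Unset Printing Implicit Defensive.
Import Order.TTheory GRing.Theory Num.Theory.
Local Open Scope ring_scope.

(** Let [K] be the clique, [d] its maximum degree as a set of edges of [G], and
    [v] a vertex of [K]-degree [d]. Let [B] be the ball of radius [t - 1] around
    [v], and let [W x] count the walks of length [t] from [v] to [x]. An edge
    meeting [B] is the last step of such a walk, so the edges of [K] inside [B]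
    number at most [\sum_(x in B) W x], and a vertex [x] outside [B] is joined
    by [K] to [h x <= W x] vertices of [B] and to [f x <= d - h x] others.
    An edge [xy] of [K] disjoint from [B] is at distance at most [t] from the
    [d] edges [vu] of [K], hence reached from each [u] by a walk of length
    [t - 1]: if [a x] counts the [u]'s with such a walk to [x], then
    [a x + a y >= d], while [a x <= d], [a x <= W x] and
    [\sum_x a x <= d * Delta ^ (t - 1)]. Charging the edge [xy] to its ends with
    weights [2 a / d - 1 / 2] rather than [a / d], the elementary inequality
    [h x + f x * (2 a x / d - 1 / 2) <= W x + a x / 2] sums to
    [#|K| <= Delta ^ t + d * Delta ^ (t - 1) / 2]. *)

(** * Walk counts and the charging inequality *)

Fixpoint nwalks {G : sgraph} (n : nat) (u x : G) : nat :=
  if n is m.+1 then (\sum_(z | adj u z) nwalks m z x)%N else (u == x).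

Section Walks.
Local Open Scope nat_scope.
Variable G : sgraph.
Implicit Types u x y z : G.

Lemma nwalksSr n u x :
  nwalks n.+1 u x = \sum_(z | adj z x) nwalks n u z.
Proof.
elim: n u => [|n IH] u.
  rewrite /= [LHS]big_mkcond [RHS]big_mkcond /=.
  rewrite (bigD1 x) //= eqxx big1 => [|z /negPf ->]; last by case: ifP.
  rewrite [RHS](bigD1 u) //= eqxx big1 => [|z]; last first.
    by rewrite eq_sym => /negPf ->; case: ifP.
  by rewrite !addn0.
rewrite [LHS]/= (eq_bigr _ (fun z _ => IH z)).
by rewrite exchange_big.
Qed.

Lemma nwalks_rcons n u x y : adj x y -> 0 < nwalks n u x -> 0 < nwalks n.+1 u y.
Proof. by move=> xy W; rewrite nwalksSr (bigD1 x) //= addn_gt0 W. Qed.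

Lemma nwalks_cons n u z x : adj u z -> 0 < nwalks n z x -> 0 < nwalks n.+1 u x.
Proof. by move=> uz W; rewrite /= (bigD1 z) //= addn_gt0 W. Qed.

(* Walk back and forth along the edge. *)
Lemma nwalks_edge m n u x y : adj x y -> m <= n -> 0 < nwalks m u x ->
  (0 < nwalks n u x) || (0 < nwalks n u y).
Proof.
move=> xy /subnK <-; elim: (n - m) => [-> //|j IH] W.
have yx : adj y x by rewrite adj_sym.
rewrite addSn; case/orP: (IH W) => {}W.
  by rewrite (nwalks_rcons xy W) orbT.
by rewrite (nwalks_rcons yx W).
Qed.

Lemma sum_nwalks Delta n u : (forall x, degree x <= Delta) ->
  \sum_x nwalks n u x <= Delta ^ n.
Proof.
move=> deg; elim: n u => [|n IH] u.
  by rewrite (bigD1 u) //= eqxx big1 // => z; rewrite eq_sym => /negPf ->.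
rewrite /= exchange_big /= expnS.
apply: (@leq_trans (\sum_(z | adj u z) Delta ^ n)); first exact: leq_sum.
by rewrite sum_nat_const leq_mul2r -cardsE deg orbT.
Qed.

End Walks.

(** The elementary inequality cleared of denominators by the factor [2 * d], with [w] for [W x]. *)
Lemma charge_ineq (d f h a w : nat) :
  (f + h <= d -> a <= d -> a <= w -> h <= w ->
   2 * d * h + 4 * f * a <= 2 * d * w + d * a + d * f)%N.
Proof.
move=> fh ad aw hw.
(* When [4 * a <= d], the weight of [f] is nonpositive. *)
have [small | /ltnW/subnKC] := leqP (4 * a) d; first nia.
set m := (4 * a - d)%N => Em.
have [b Eb] : exists b, d = (a + b)%N by exists (d - a)%N; rewrite subnKC.
(* Here [m = 3 * a - b], so [d * a - b * m] is the square of [a - b]. *)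
have bm : (b * m <= d * a)%N.
  have [agm _] := nat_AGM2 a b; rewrite -Eb -mulnn in agm.
  have := congr1 (muln b) Em; have := congr1 (muln d) Eb.
  by rewrite !mulnDr; lia.
have -> : (4 * f * a = d * f + f * m)%N.
  by rewrite mulnAC -Em mulnDl (mulnC m).
suff : (2 * d * h + f * m <= 2 * d * w + d * a)%N by lia.
have dhw : (d * h <= d * w)%N by rewrite leq_mul2l hw orbT.
have daw : (d * a <= d * w)%N by rewrite leq_mul2l aw orbT.
(* If [a < h], then [f <= b] and [bm] suffices. Otherwise [f <= d - h] leaves a bound linear in [h]
   on [[0, a]]; the sign of its slope [2 * d - m] tells which endpoint is worst. *)
have [ha | ah] := leqP h a; last first.
  have : (f * m <= b * m)%N by rewrite leq_mul2r; lia.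
  lia.
have fm : (f * m + h * m <= d * m)%N by rewrite -mulnDl leq_mul2r fh orbT.
have [m2 | m2] := leqP m (2 * d).
  have : (h * (2 * d - m) <= a * (2 * d - m))%N by rewrite leq_mul2r ha orbT.
  nia.
have : (h * (2 * d) <= h * m)%N by rewrite leq_mul2l ltnW ?orbT.
have : (d * m <= d * (3 * a))%N by rewrite leq_mul2l; lia.
nia.
Qed.

(** * The bound for an abstract edge relation *)

Section EdgeRelation.
Local Open Scope nat_scope.
Variables (G : sgraph) (Delta s : nat) (k : rel G).
Hypothesis deg : forall x : G, degree x <= Delta.
Hypotheses (ksym : symmetric k) (kadj : subrel k (@adj G)).
Hypothesis kclose : forall v u x y : G, k v u -> k x y ->
  exists i a b, [/\ i <= s, a \in [set v; u], b \in [set x; y]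
                  & 0 < nwalks i a b].

(** [k] stands for the clique and [s] for [t - 1]; each edge counts as two ordered pairs, which
    doubles the bound. *)
Lemma count_close_edges : \sum_x \sum_y k x y <= 3 * Delta ^ s.+1.
Proof.
have [/bigop.eq_bigmax|G0] := ltnP 0 #|G|; last first.
  rewrite big1 // => x _; have := max_card (pred1 x).
  by rewrite card1 leqNgt ltnS (leq_trans G0).
move=> /(_ (fun x => \sum_y k x y)) [v vmax].
set d := \sum_y k v y in vmax.
have kdeg x : \sum_y k x y <= d by rewrite -vmax; apply: bigop.leq_bigmax.
have [d0|d_gt0] := posnP d.
  by rewrite big1 // => x _; apply/eqP; have := kdeg x; rewrite d0 leqn0.
have dDelta : d <= Delta.
  apply: leq_trans (deg v); rewrite /degree -sum1_card big_mkcond /=.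
  by apply: leq_sum => y _; rewrite inE; case: (boolP (k v y)) => // /kadj ->.
pose B := [pred x | [exists i : 'I_s.+1, 0 < nwalks i v x]].
have inB i x : i <= s -> 0 < nwalks i v x -> x \in B.
  by move=> lis W; apply/existsP; exists (Ordinal (n := s.+1) (m := i) lis).
have B_last x y : x \in B -> adj x y -> (0 < nwalks s v x) || (0 < nwalks s v y).
  by case/existsP=> i W xy; apply: nwalks_edge xy _ W; rewrite -ltnS.
pose W x := nwalks s.+1 v x.
pose h x := \sum_(y | y \in B) k x y.
pose f x := \sum_(y | y \notin B) k x y.
pose a x := \sum_(u | k v u) (0 < nwalks s u x).
have fh x : f x + h x <= d.
  by rewrite addnC; apply: leq_trans (kdeg x); rewrite [leqRHS](bigID (mem B)).
have dE : d = \sum_(u | k v u) 1.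
  by rewrite /d [RHS]big_mkcond; apply: eq_bigr => y _; case: (k v y).
have ad x : a x <= d by rewrite dE; apply: leq_sum => u _; case: (0 < _).
have aW x : a x <= W x.
  rewrite /a /W /= big_mkcond [leqRHS]big_mkcond; apply: leq_sum => u _.
  by case: (boolP (k v u)) => // /kadj ->; case: (nwalks s u x).
have hW x : x \notin B -> h x <= W x.
  move=> xB; rewrite /h /W nwalksSr big_mkcond [leqRHS]big_mkcond.
  apply: leq_sum => z _; case: ifP => // zB.
  case: (boolP (k x z)) => // /kadj xz; rewrite adj_sym xz.
  have zx : adj z x by rewrite adj_sym.
  case/orP: (B_last _ _ zB zx) => // Wx.
  by rewrite (inB s) in xB.
have sum_a : \sum_x a x <= d * Delta ^ s.
  rewrite exchange_big dE big_distrl /=; apply: leq_sum => u _.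
  rewrite mul1n; apply: leq_trans (sum_nwalks s u deg).
  by apply: leq_sum => x _; case: (nwalks s u x).
have inner : \sum_(x | x \in B) h x <= 2 * \sum_(x | x \in B) W x.
  (* An edge inside [B] is the last step of a walk of length [s + 1] from [v] in at least one
     direction. *)
  pose c x y := adj x y && (0 < nwalks s v x).
  have cW y : \sum_(x | x \in B) c x y <= W y.
    rewrite /W nwalksSr big_mkcond [leqRHS]big_mkcond; apply: leq_sum => x _.
    by case: ifP => // _; rewrite /c; case: (adj x y) => //=; case: (nwalks s v x).
  have h_c : \sum_(x | x \in B) h x <=
      \sum_(x | x \in B) \sum_(y | y \in B) (c x y + c y x).
    apply: leq_sum => x xB; apply: leq_sum => y yB.
    case: (boolP (k x y)) => // /kadj xy.
    rewrite /c (adj_sym y) xy /=.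
    by case/orP: (B_last _ _ xB xy) => ->; rewrite ?addn1.
  apply: leq_trans h_c _.
  under eq_bigr do rewrite big_split; rewrite big_split /=.
  rewrite mul2n -addnn; apply: leq_add; last by apply: leq_sum => x _.
  by rewrite exchange_big; apply: leq_sum => x _.
have pair_a x y : x \notin B -> y \notin B -> k x y -> d <= a x + a y.
  move=> xB yB kxy; rewrite dE /a -big_split /=; apply: leq_sum => u vu.
  have [i [p [q [lis pv qx Wpq]]]] := kclose vu kxy.
  (* As [q] is outside [B], the walk starts at [u], not [v]. Were it shorter than [s], prepending
     the step from [v] to [u] would put [q] in [B]. *)
  have qB : q \notin B by case/set2P: qx => ->.
  case/set2P: pv Wpq => -> Wpq; first by rewrite (inB i) in qB.
  have Ei : i = s.
    apply/eqP; rewrite eqn_leq lis leqNgt; apply/negP => lt_is.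
    by rewrite (inB i.+1) // (nwalks_cons (kadj vu)) in qB.
  by rewrite Ei in Wpq; case/set2P: qx Wpq => -> ->; rewrite ?addn1.
have outer : d * \sum_(x | x \notin B) f x <= 2 * \sum_(x | x \notin B) f x * a x.
  have step : d * \sum_(x | x \notin B) f x <=
      \sum_(x | x \notin B) \sum_(y | y \notin B) (k x y * a x + k y x * a y).
    rewrite big_distrr /=; apply: leq_sum => x xB.
    rewrite big_distrr /=; apply: leq_sum => y yB; rewrite (ksym y).
    by case: (boolP (k x y)) => kxy; rewrite ?muln0 // muln1 !mul1n pair_a.
  apply: leq_trans step _.
  under eq_bigr do rewrite big_split; rewrite big_split /= mul2n -addnn.
  rewrite [X in _ + X]exchange_big /=.
  by apply: leq_add; apply: leq_sum => x _; rewrite /f big_distrl.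
have cross : \sum_(x | x \in B) f x = \sum_(x | x \notin B) h x.
  rewrite exchange_big; apply: eq_bigr => y _.
  by apply: eq_bigr => x _; rewrite ksym.
(* An edge leaving [B] is counted once from each end, hence the factor 2. *)
have total : \sum_x \sum_y k x y = \sum_(x | x \in B) h x
    + 2 * \sum_(x | x \notin B) h x + \sum_(x | x \notin B) f x.
  have -> : \sum_x \sum_y k x y = \sum_x (h x + f x).
    by apply: eq_bigr => x _; rewrite (bigID (mem B)).
  by rewrite (bigID (mem B)) /= !big_split /= cross; lia.
have charge : 2 * d * (\sum_(x | x \notin B) h x)
      + 4 * \sum_(x | x \notin B) f x * a x
    <= 2 * d * (\sum_(x | x \notin B) W x) + d * (\sum_(x | x \notin B) a x)
      + d * \sum_(x | x \notin B) f x.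
  clearbody d; rewrite !big_distrr -!big_split /=; apply: leq_sum => x xB.
  by rewrite mulnA; apply: charge_ineq => //; apply: hW.
have sum_W : \sum_(x | x \in B) W x + \sum_(x | x \notin B) W x <= Delta ^ s.+1.
  by have := sum_nwalks s.+1 v deg; rewrite (bigID (mem B)).
have sum_aN : \sum_(x | x \notin B) a x <= d * Delta ^ s.
  by apply: leq_trans sum_a; rewrite [leqRHS](bigID (mem B)) leq_addl.
have dDs : d * Delta ^ s <= Delta ^ s.+1 by rewrite expnS leq_mul2r dDelta orbT.
(* After scaling by [d], [outer] eliminates the sum of [f x * a x] from [charge]; adding [inner]
   leaves [2 * d] times the sum of [W] plus [d] times the sum of [a]. *)
rewrite -(leq_pmul2l d_gt0) total; nia.
Qed.

End EdgeRelation.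

(** * From distances in the line graph to walks in [G] *)

Section LineDistance.
Local Open Scope nat_scope.
Variable G : sgraph.
Implicit Types (E F : line_graph G).

Lemma edge_adj E x y : x \in val E -> y \in val E -> x != y -> adj x y.
Proof.
case: E => E /= /imsetP[p]; rewrite inE => padj -> /set2P[]-> /set2P[]-> //.
- by rewrite eqxx.
- by rewrite adj_sym.
- by rewrite eqxx.
Qed.

(** Consecutive edges share a vertex, so each step of the path costs at most one step in [G]. *)
Lemma line_path_nwalks E (p : seq (line_graph G)) a :
  path (@adj (line_graph G)) E p -> a \in val E ->
  exists i b, [/\ i <= size p, b \in val (last E p) & 0 < nwalks i a b].
Proof.
elim: p E a => [|F p IH] E a /=.
  by move=> _ aE; exists 0, a; rewrite aE /= eqxx.
case/andP=> /andP[_ /set0Pn[c /setIP[cE cF]]] pth aE.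
have [i [b [lei bl Wb]]] := IH F c pth cF.
have [<-|neq] := eqVneq c a; first by exists i, b; rewrite ltnW.
exists i.+1, b; split => //; apply: nwalks_cons Wb.
by apply: edge_adj aE cE _; rewrite eq_sym.
Qed.

(** Starting at the vertex shared by the first two edges of a shortest path saves one step. Equal
    edges are included because [kclose] also compares an edge with itself. *)
Lemma power_line_nwalks s E F :
  (E == F) || @adj (graph_power (line_graph G) s.+1) E F ->
  exists i a b, [/\ i <= s, a \in val E, b \in val F & 0 < nwalks i a b].
Proof.
have self E' : exists2 a, a \in val E' & nwalks 0 a a = 1.
  case: E' => E' /= /imsetP[p _ ->]; exists p.1; first exact: set21.
  by rewrite eqxx.
case/orP=> [/eqP <-|]; first by have [a aE W] := self E; exists 0, a, a; rewrite W.
case/andP=> neq; rewrite /dist; case: {-}_ / idP => // cEF.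
case: ex_minnP => d /existsP[p /andP[pth /eqP Fl]] _ led.
case: p pth Fl => [[|E' p] /= /eqP szp]; first by move=> _ FE; rewrite FE eqxx in neq.
case/andP=> /andP[_ /set0Pn[c /setIP[cE cE']]] pth Fl.
have [i [b [lei bF W]]] := line_path_nwalks pth cE'.
by exists i, c, b; rewrite Fl; split; rewrite // -ltnS (leq_trans _ led) // -szp ltnS.
Qed.

Lemma clique_bound Delta s (K : {set graph_power (line_graph G) s.+1}) :
  (forall x : G, degree x <= Delta) -> clique K -> 2 * #|K| <= 3 * Delta ^ s.+1.
Proof.
move=> deg Kc.
pose k x y := adj x y && [exists E in K, val (E : edge_type G) == [set x; y]].
have kE x y : k x y -> exists2 E : edge_type G, E \in K & val E = [set x; y].
  by case/andP=> _ /existsP[E /andP[EK /eqP]]; exists E.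
apply: leq_trans (@count_close_edges G Delta s k deg _ _ _).
- rewrite pair_big /= mulnC -sum_nat_const.
  pose c (E : edge_type G) (p : G * G) := adj p.1 p.2 && (val E == [set p.1; p.2]).
  (* An edge has two orientations, distinct since there are no loops. *)
  have c2 (E : edge_type G) : 2 <= \sum_p c E p.
    have /imsetP[[x y]] := valP E; rewrite inE /= => xy Exy.
    have neq : (y, x) != (x, y).
      by apply/eqP=> -[yx _]; move: xy; rewrite yx adj_irr.
    rewrite (bigD1 (x, y)) //= (bigD1 (y, x)) //= /c /= Exy (adj_sym y) xy.
    by rewrite setUC !eqxx.
  apply: leq_trans (_ : \sum_(E in K) \sum_p c E p <= _); first exact: leq_sum.
  rewrite exchange_big; apply: leq_sum => -[x y] _ /=.
  (* Conversely, an ordered pair determines its edge, so it is counted at most once. *)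
  have [kxy|nk] := boolP (k x y).
    have [E EK Exy] := kE _ _ kxy.
    rewrite (bigD1 E) //= big1 ?addn0 ?leq_b1 // => F /andP[_ FE].
    apply/eqP; rewrite eqb0 /c /= negb_and; apply/orP; right.
    by apply: contra FE => /eqP FE; apply/eqP/val_inj; apply: etrans FE (esym Exy).
  rewrite big1 // => E EK; apply/eqP; rewrite eqb0; apply: contra nk.
  by case/andP=> xy Exy; rewrite /k xy; apply/existsP; exists E; rewrite EK.
- by move=> x y; rewrite /k adj_sym setUC.
- by move=> x y /andP[].
move=> v u x y /kE[E EK <-] /kE[F FK <-].
apply: power_line_nwalks; case: eqVneq => //= neq.
by move/forall_inP: Kc => /(_ _ EK) /forall_inP /(_ _ FK); rewrite neq.
Qed.

End LineDistance.

Theorem theorem8 (t Delta : nat) (ht : (1 <= t)%N) (hDelta : (1 <= Delta)%N)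
    (G : sgraph) (hG : max_degree G = Delta) :
  (clique_number (graph_power (line_graph G) t))%:R
    <= 3%:R / 2%:R * Delta%:R ^+ t :> rat.
Proof.
case: t ht => // s _.
have deg (x : G) : (degree x <= Delta)%N by rewrite -hG; apply: bigop.leq_bigmax.
have : (2 * clique_number (graph_power (line_graph G) s.+1) <= 3 * Delta ^ s.+1)%N.
  rewrite /clique_number; elim/big_ind: _ => [//|m n|K Kc]; first lia.
  exact: clique_bound deg Kc.
rewrite -(ler_nat rat) !natrM natrX mulrAC => le2.
by rewrite ler_pdivlMr ?ltr0n // mulrC.
Qed.
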